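(* Let $p$ be a prime number, let $P(z) = z + z^2 \in \mathbb{C}_p[z]$ and let $B = \{z \in \mathbb{C}_p : |z| < 1\}$. Then $B$ is an infraconnected open set, $P(B) = B$, and $|P(x) - P(y)| = |x - y|$ for all $x, y \in B$; in particular $$\left| \frac{P(x) - P(y)}{x - y} \right|^2 = |P'(x) \cdot P'(y)| \quad \text{for all distinct } x, y \in B.$$ Moreover, the restriction $P|_B$ is an analytic element on $B$, but $P|_B$ is not bi-analytic.
   Context: $\mathbb{C}_p$ is the smallest algebraically closed and complete extension of the field $\mathbb{Q}_p$ of $p$-adic numbers, with norm $|\cdot|$. An analytic element on a subset $D \subset \mathbb{C}_p$ is a function $D \to \mathbb{C}_p$ that is a uniform limit on $D$ of rational functions in $\mathbb{C}_p(z)$ without poles in $D$. An injective analytic element on $D$ whose inverse (a function defined on its image) is also an analytic element is called bi-analytic. A subset $D \subset \mathbb{C}_p$ is infraconnected if for all $a \in \mathbb{C}_p$ and $r' > r > 0$ such that $\{z : r < |z-a| < r'\}$ is disjoint from $D$, one has $D \subset \{z : |z-a| \le r\}$ or $D \cap \{z : |z-a| < r'\} = \emptyset$. *)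

(* Defs.v *)
From HB Require Import structures.
From mathcomp Require Import all_boot all_order all_algebra.
From mathcomp Require Import all_classical all_reals all_analysis.

Set Implicit Arguments.
Unset Strict Implicit.
Unset Printing Implicit Defensive.

Import Order.TTheory GRing.Theory Num.Theory.
Local Open Scope classical_set_scope.
Local Open Scope ring_scope.

(* The norm of a [normedZmodType] satisfies [`|x *+ n| = `|x| *+ n], which
   excludes ultrametric norms; hence a separate structure. *)
HB.mixin Record Field_isUltrametric (R : realType) K of GRing.Field K := {
  unorm : K -> R;
  unorm_ge0 : forall x, 0 <= unorm x;
  unorm_eq0 : forall x, (unorm x == 0) = (x == 0);
  unormM : {morph unorm : x y / x * y};
  unormD : forall x y, unorm (x + y) <= Num.max (unorm x) (unorm y)
}.

#[short(type="ultrametricFieldType")]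
HB.structure Definition UltrametricField (R : realType) :=
  {K of GRing.Field K & Field_isUltrametric R K}.

Section UltrametricTopology.
Context (R : realType) (K : ultrametricFieldType R).
Implicit Types x y z : K.

Lemma unorm1 : unorm (1 : K) = 1.
Proof.
have n0 : unorm (1 : K) != 0 by rewrite unorm_eq0 oner_eq0.
by apply: (mulfI n0); rewrite -unormM !mulr1.
Qed.

Lemma unormN x : unorm (- x) = unorm x.
Proof.
have /eqP : unorm (-1 : K) ^+ 2 = 1.
  by rewrite expr2 -unormM mulrNN mulr1 unorm1.
rewrite sqrf_eq1 => /orP[/eqP N1|/eqP N1].
  by rewrite -mulN1r unormM N1 mul1r.
by have := unorm_ge0 (-1 : K); rewrite N1 oppr_ge0 ler10.
Qed.

Let uball_center x (e : R) : 0 < e -> ball_ (@unorm R K) x e x.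
Proof.
have /eqP n0 : unorm (0 : K) == 0 by rewrite unorm_eq0 eqxx.
by rewrite /= subrr n0.
Qed.

Let uball_sym x y (e : R) :
  ball_ (@unorm R K) x e y -> ball_ (@unorm R K) y e x.
Proof. by rewrite /= -unormN opprB. Qed.

Let uball_triangle x y z (e1 e2 : R) : ball_ (@unorm R K) x e1 y ->
  ball_ (@unorm R K) y e2 z -> ball_ (@unorm R K) x (e1 + e2) z.
Proof.
move=> /= xy yz; have -> : x - z = (x - y) + (y - z) by rewrite addrA subrK.
have e10 : 0 < e1 by exact: le_lt_trans (unorm_ge0 _) xy.
have e20 : 0 < e2 by exact: le_lt_trans (unorm_ge0 _) yz.
apply: le_lt_trans (unormD _ _) _; rewrite gt_max.
by rewrite (lt_trans xy) ?ltrDl// (lt_trans yz) ?ltrDr.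
Qed.

HB.instance Definition _ := hasNbhs.Build K
  (nbhs_ (entourage_ (ball_ (@unorm R K)))).
HB.instance Definition _ := @Nbhs_isPseudoMetric.Build R K
  (entourage_ (ball_ (@unorm R K))) erefl (ball_ (@unorm R K))
  uball_center uball_sym uball_triangle erefl.

End UltrametricTopology.

(* The exponent is v_p (denq q) - v_p (numq q) = - v_p q. *)
Definition padic_norm (R : realType) (p : nat) (q : rat) : R :=
  if q == 0 then 0
  else p%:R ^ ((logn p `|denq q|%N)%:Z - (logn p `|numq q|%N)%:Z).

Section PadicComplex.
Context (R : realType) (K : ultrametricFieldType R).

Definition complete_set (A : set K) : Prop :=
  forall G : set_system K, ProperFilter G -> G A -> cauchy G ->
    exists2 x, A x & G --> x.

Definition complete_algclosed_subfield (F : {pred K}) : Prop :=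
  [/\ divring_closed F,
      complete_set [set` F] &
      forall q : {poly K}, q \is a polyOver F -> (1 < size q)%N ->
        exists2 x, x \in F & root q x].

(* K is (isometrically isomorphic to) C_p.  When the prime subfield of K is Q
   with its p-adic norm, each complete subfield of K contains the closure of Q
   in K, which is Q_p, so it is an extension of Q_p. *)
Definition is_padic_complex (p : nat) : Prop :=
  [/\ forall q : rat, unorm (ratr q : K) = padic_norm R p q,
      complete_algclosed_subfield predT &
      forall F : {pred K}, complete_algclosed_subfield F -> F =i predT].

End PadicComplex.

Section AnalyticElements.
Context (R : realType) (K : ultrametricFieldType R).
Implicit Types (D : set K) (f g : K -> K).

(* A function on D is represented by a total function on K, of which only the
   values on D matter. *)
Definition rational_without_poles D f : Prop :=
  exists N Q : {poly K},
    forall z, D z -> Q.[z] != 0 /\ f z = N.[z] / Q.[z].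

Definition analytic_element D f : Prop :=
  exists r : nat -> K -> K,
    (forall n, rational_without_poles D (r n)) /\
    {uniform D, r @ \oo --> f}.

Definition bi_analytic D f : Prop :=
  [/\ set_inj D f, analytic_element D f &
      exists g, (forall z, D z -> g (f z) = z) /\
                analytic_element (f @` D) g].

Definition infraconnected D : Prop :=
  forall (a : K) (r r' : R), 0 < r -> r < r' ->
    [set z | r < unorm (z - a) < r'] `&` D = set0 ->
    D `<=` [set z | unorm (z - a) <= r] \/
    D `&` [set z | unorm (z - a) < r'] = set0.

End AnalyticElements.

(* Main.v *)
(* Only the last claim is not elementary.  The inverse g of P on B satisfies
   g + g^2 = z.  Were g a uniform limit of rational functions on B, some N / Q
   would satisfy this equation up to an error less than 1 in norm; as norms of
   polynomials are continuous across the unit circle, the same holds slightly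
   outside B, where it forces |N / Q|^2 = |z|.  But |N / Q| is there a constant
   times an integer power of |z|, so a square root of |z| would be one too.
   This works for every residue characteristic, p = 2 included. *)
Require Import Defs.
From mathcomp Require Import all_boot all_order all_algebra.
From mathcomp Require Import all_classical all_reals all_analysis.
From mathcomp Require Import ring lra.
Import Order.TTheory GRing.Theory Num.Theory.
Local Open Scope classical_set_scope.
Local Open Scope ring_scope.

(** * Powers of real numbers *)

(** Bernoulli's inequality. The exponent is a successor because it enters the degree of a polynomial
    that must have a root. *)
Lemma exists_expr_gt (R : realType) (x y : R) :
  1 < x -> exists n, y < x ^+ n.+1.
Proof.
move=> x1; have e0 : 0 < x - 1 by rewrite subr_gt0.
have B n : 1 + (x - 1) *+ n <= x ^+ n.
  elim: n => [|n IH]; first by rewrite mulr0n addr0 expr0.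
  have x0 : 0 <= x by lra.
  rewrite exprS mulrSr; apply: le_trans (ler_wpM2l x0 IH).
  have : 0 <= (x - 1) * ((x - 1) *+ n) by rewrite mulr_ge0 ?mulrn_wge0 // ltW.
  lra.
pose n := Num.bound `|y / (x - 1)|.
have nP : y / (x - 1) < n%:R.
  exact: le_lt_trans (ler_norm _) (archi_boundP (normr_ge0 _)).
exists n; apply: lt_le_trans (B n.+1).
by move: n nP => n; rewrite ltr_pdivrMr // mulr_natl mulrSr; lra.
Qed.

(** * Ultrametric inequalities and analytic elements *)

Section UltrametricNorm.
Set Implicit Arguments.
Unset Strict Implicit.
Context (R : realType) (K : ultrametricFieldType R).
Implicit Types x y z : K.

Lemma unorm0 : unorm (0 : K) = 0.
Proof. by apply/eqP; rewrite unorm_eq0. Qed.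

Lemma unorm_gt0 x : (0 < unorm x) = (x != 0).
Proof. by rewrite lt0r unorm_ge0 andbT unorm_eq0. Qed.

Lemma unormX x n : unorm (x ^+ n) = unorm x ^+ n.
Proof. by elim: n => [|n IH]; rewrite ?unorm1 // !exprS unormM IH. Qed.

Lemma unormV x : unorm x^-1 = (unorm x)^-1.
Proof.
have [->|x0] := eqVneq x 0; first by rewrite invr0 unorm0 invr0.
have u0 : unorm x != 0 by rewrite unorm_eq0.
by apply: (mulfI u0); rewrite -unormM !divff // unorm1.
Qed.

Lemma unormD_le x y (c : R) : unorm x <= c -> unorm y <= c -> unorm (x + y) <= c.
Proof. by move=> xc yc; rewrite (le_trans (unormD _ _)) // ge_max xc. Qed.

Lemma unormD_lt x y (c : R) : unorm x < c -> unorm y < c -> unorm (x + y) < c.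
Proof. by move=> xc yc; rewrite (le_lt_trans (unormD _ _)) // gt_max xc. Qed.

(** If the sum were smaller than [y] in norm, so would be [y = - x + (x + y)]. *)
Lemma unormDr x y : unorm x < unorm y -> unorm (x + y) = unorm y.
Proof.
move=> xy; apply/eqP; rewrite eq_le unormD_le ?(ltW xy) //= leNgt.
apply/negP => lt_xy_y; have : unorm (- x + (x + y)) < unorm y.
  by rewrite unormD_lt ?unormN.
by rewrite addKr ltxx.
Qed.

Lemma unormDl x y : unorm x < unorm y -> unorm (y + x) = unorm y.
Proof. by rewrite addrC; exact: unormDr. Qed.

Lemma unormBr x y : unorm x < unorm y -> unorm (x - y) = unorm y.
Proof. by move=> xy; rewrite unormDr unormN. Qed.

Lemma unormBl x y : unorm x < unorm y -> unorm (y - x) = unorm y.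
Proof. by move=> xy; rewrite unormDl ?unormN. Qed.

Lemma open_unorm_lt1 : open [set z : K | unorm z < 1].
Proof.
rewrite openE => x /= x1; apply/nbhs_ballP; exists 1 => //= y xy.
have : unorm (x - (x - y)) < 1 by rewrite unormD_lt ?unormN.
by rewrite subKr.
Qed.

Lemma analytic_element_poly (D : set K) (F : {poly K}) :
  analytic_element D (horner F).
Proof.
exists (fun=> horner F); split; last exact: (@cvg_cst {uniform` D -> K}).
by move=> n; exists F, 1 => z _; rewrite hornerC oner_eq0 divr1.
Qed.

Lemma analytic_element_approx (D : set K) (f : K -> K) (e : R) :
  0 < e -> analytic_element D f ->
  exists N Q : {poly K}, forall z, D z ->
    Q.[z] != 0 /\ unorm (N.[z] / Q.[z] - f z) < e.
Proof.
move=> e0 [r [rat_r cvg_r]].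
have : nbhs (f : {uniform` D -> K})
    [set h : {uniform` D -> K} | forall z, D z -> unorm (f z - h z) < e].
  apply/uniform_nbhs; exists [set xy | ball xy.1 e xy.2]; split=> //.
  exact: (@entourage_ball R K (PosNum e0)).
move=> /cvg_r[n _ /(_ n (leqnn n))/= fr].
have [N [Q NQ]] := rat_r n; exists N, Q => z Dz.
have [Q0 rz] := NQ z Dz; split => //.
by rewrite -unormN opprB -rz; exact: fr.
Qed.

(** * Norm values and polynomials over an algebraically closed field *)

Hypothesis K_closed :
  forall F : {poly K}, (1 < size F)%N -> exists x, root F x.

Lemma exists_unorm_near1 (c : K) (d : R) (m : nat) :
  0 < unorm c < 1 -> 1 < d ->
  exists z : K, 1 < unorm z /\ unorm z ^+ m.+1 < d.
Proof.
move=> /andP[c0 c1] d1; have [n dn] := @exists_expr_gt R d (unorm c)^-1 d1.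
(* For z = 1/w this degree gives |z|^((m+1)(n+1)) = 1/|c| < d^(n+1); it remains to take (n+1)-th
   roots. *)
have [w /rootP] : exists w, root ('X^(m.+1 * n.+1) - c%:P) w.
  by apply: K_closed; rewrite size_XnsubC.
rewrite !hornerE => /eqP; rewrite subr_eq0 => /eqP wn.
have uz : unorm w^-1 ^+ (m.+1 * n.+1) = (unorm c)^-1.
  by rewrite -unormX exprVn wn unormV.
exists w^-1; split.
  rewrite -(@expr_gt1 _ (m.+1 * n.+1)) ?unorm_ge0 // uz.
  by rewrite invf_gt1.
rewrite -(@ltr_pXn2r _ n.+1) ?nnegrE ?exprn_ge0 ?unorm_ge0 //; last by lra.
by rewrite -exprM uz.
Qed.

(** Choose |z| > 1 below s/r: successive powers of 1/|z| then shrink too slowly to jump over the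
    interval from r to s. *)
Lemma exists_unorm_between (c : K) (r s : R) : 0 < unorm c < 1 ->
  0 < r -> r < s -> s <= 1 -> exists z : K, r < unorm z < s.
Proof.
move=> c01 r0 rs s1; have s0 : 0 < s by lra.
have [|z [z1 zd]] := @exists_unorm_near1 c (s / r) 0 c01.
  by rewrite ltr_pdivlMr // mul1r.
have z0 : 0 < unorm z by lra.
have ex : exists n, unorm z ^- n < s.
  have [n] := @exists_expr_gt R (unorm z) s^-1 z1.
  by exists n.+1; rewrite invf_plt ?posrE // exprn_gt0.
(* Exponent 0 is excluded by [s <= 1]. The power before the first one below s is at least s, so the
   first one exceeds r. *)
case: (ex_minnP ex) => -[|k] ks kmin; first by move: ks; rewrite expr0 invr1; lra.
exists (z^-1 ^+ k.+1); rewrite unormX unormV exprVn ks andbT.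
have : ~~ (unorm z ^- k < s) by apply/negP => /kmin; rewrite ltnn.
rewrite -leNgt => sk; rewrite exprS invfM.
have : r * unorm z < s by rewrite ltr_pdivlMr // in zd; rewrite mulrC.
move=> rzs; rewrite mulrC ltr_pdivlMr //; lra.
Qed.

(* Near the unit circle, the norm of a polynomial is a monomial in [unorm z]
   on either side, with the same constant C (the Gauss norm of F). *)
Lemma unorm_horner_near_circle (F : {poly K}) :
  exists (C : R) (k l : nat), exists2 d : R, 1 < d &
    (F != 0 -> 0 < C) /\
    forall z, 1 < unorm z < d ->
      unorm F.[z] = C * unorm z ^+ k /\ unorm F.[z^-1] * unorm z ^+ l = C.
Proof.
elim: {F}(size F) {-2}F (leqnn (size F)) => [|n IH] F.
  rewrite leqn0 size_poly_eq0 => /eqP ->; exists 0, 0, 0, 2; first by lra.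
  by rewrite eqxx; split => // z _; rewrite !horner0 unorm0 !mul0r.
move=> sF; have [|F1] := leqP (size F) 1.
  move=> /size1_polyC ->; exists (unorm F`_0), 0, 0, 2; first by lra.
  by rewrite polyC_eq0 unorm_gt0; split => // z _; rewrite !hornerC !mulr1.
have [a /factor_theorem[G FG]] := K_closed F1.
have F0 : F != 0 by rewrite -size_poly_gt0; case: size F1.
have G0 : G != 0 by apply: contraNneq F0 => G0; rewrite FG G0 mul0r.
have [|C [k [l [d d1 [C0 CP]]]]] := IH G.
  by move: sF; rewrite FG size_Mmonic ?monicXsubC // size_XsubC addn2.
(* The factor X - a has the norm of the point on both sides of the circle if |a| < 1, the norm |a|
   on both sides if |a| > 1, and if |a| = 1 the norm of the point outside and 1 inside. *)
have [a1|a1|a1] := ltgtP (unorm a) 1.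
(* The points 1/z must stay farther out than a. The root 0 is set apart because [0^-1 = 0] would
   spoil the minimum. *)
- pose d' := if a == 0 then d else Num.min d (unorm a)^-1.
  have d'1 : 1 < d'.
    rewrite /d'; case: eqVneq => // a0.
    by rewrite lt_min d1 invf_gt1 ?unorm_gt0.
  exists C, k.+1, l.+1, d' => //; split=> [_|z /andP[z1 zd]]; first exact: C0.
  have z0 : 0 < unorm z by lra.
  have zd1 : 1 < unorm z < d.
    rewrite z1 (lt_le_trans zd) // /d'; case: eqVneq => // _.
    by rewrite ge_min lexx.
  have az : unorm a < unorm z^-1.
    rewrite unormV; have [->|a0] := eqVneq a 0; first by rewrite unorm0 invr_gt0.
    move: zd; rewrite /d' (negPf a0) lt_min => /andP[_].
    by move=> za; rewrite -[unorm a]invrK ltf_pV2 ?posrE ?invr_gt0 // unorm_gt0.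
  have [e1 e2] := CP z zd1; rewrite FG !hornerM !hornerXsubC !unormM e1.
  rewrite (unormBl az) unormBl ?unormV; last by lra.
  split; first by rewrite exprSr mulrA.
  by rewrite exprS mulrA divfK ?gt_eqF.
- exists (C * unorm a), k, l, (Num.min d (unorm a)); first by rewrite lt_min d1.
  have a0 : 0 < unorm a by lra.
  split=> [_|z /andP[z1]]; first by rewrite mulr_gt0 ?C0.
  rewrite lt_min => /andP[zd za].
  have [|e1 e2] := CP z; first by rewrite z1.
  have zV : unorm z^-1 < unorm a.
    by rewrite unormV (lt_trans _ a1) // invf_lt1 //; lra.
  rewrite FG !hornerM !hornerXsubC !unormM e1 (unormBr za) (unormBr zV).
  by rewrite mulrAC; split=> //; rewrite mulrAC e2.
- exists C, k.+1, l, d => //; split=> [_|z z1d]; first exact: C0.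
  have [e1 e2] := CP z z1d; have z1 : 1 < unorm z by case/andP: z1d.
  have zV : unorm z^-1 < unorm a by rewrite a1 unormV invf_lt1 //; lra.
  rewrite FG !hornerM !hornerXsubC !unormM e1 (unormBr zV) a1 mulr1.
  by rewrite unormBl ?a1 // exprSr mulrA.
Qed.

(** * The quadratic equation of the inverse branch *)

(** The term z q^2 dominates the error, so |n (n + q)| = |z| |q|^2 > |q|^2. This rules out |n| <=
    |q|, and then |n + q| = |n|. *)
Lemma unorm_quadratic_root (n q z : K) : 1 < unorm z ->
  unorm (n ^+ 2 + n * q - z * q ^+ 2) < unorm q ^+ 2 ->
  unorm n ^+ 2 = unorm z * unorm q ^+ 2.
Proof.
set h := _ - _ => z1 hq; have q2 : 0 < unorm q ^+ 2.
  exact: le_lt_trans (unorm_ge0 _) hq.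
have q0 := unorm_ge0 q; have n0 := unorm_ge0 n.
have hz : unorm h < unorm (z * q ^+ 2).
  by rewrite unormM unormX (lt_trans hq) // ltr_pMl.
have nq : unorm (n * (n + q)) = unorm z * unorm q ^+ 2.
  rewrite -unormX -unormM -(unormDr hz); congr unorm; rewrite /h; ring.
have [qn|nq'] := ltP (unorm q) (unorm n).
  by rewrite -nq unormM unormDl.
suff : unorm (n * (n + q)) <= unorm q ^+ 2.
  by rewrite nq leNgt ltr_pMl // z1.
by rewrite unormM expr2 ler_pM ?unorm_ge0 // unormD_le.
Qed.

(* N^2 + N Q - z Q^2 is small relative to Q^2 inside the unit circle, hence also
   slightly outside it: this is where |N|^2 = |z| |Q|^2 at both t and t^2 equates
   an even and an odd power of |t|. *)
Lemma quadratic_branch_not_rational (c : K) (g : K -> K) (N Q : {poly K}) :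
  0 < unorm c < 1 ->
  (forall w, unorm w < 1 -> unorm (g w) < 1 /\ g w + g w ^+ 2 = w) ->
  ~ (forall w, unorm w < 1 ->
       Q.[w] != 0 /\ unorm (N.[w] / Q.[w] - g w) < 2^-1).
Proof.
move=> c01 gP NQ.
pose H := N ^+ 2 + N * Q - 'X * Q ^+ 2.
have Q0 : Q != 0.
  have [|Q0 _] := NQ 0; first by rewrite unorm0.
  by apply: contraNneq Q0 => ->; rewrite horner0.
have HQ w : unorm w < 1 -> unorm H.[w] <= 2^-1 * unorm Q.[w] ^+ 2.
  move=> w1; have [q0 fg] := NQ w w1; have [g1 gw] := gP w w1.
  set f := N.[w] / Q.[w] in fg.
  (* Since g + g^2 = w, f + f^2 - w is (f - g)(1 + f + g), whose second factor has norm at most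
     1. *)
  have -> : H.[w] = (f - g w) * (1 + (g w + g w + (f - g w))) * Q.[w] ^+ 2.
    transitivity (N.[w] ^+ 2 + N.[w] * Q.[w] - (g w + g w ^+ 2) * Q.[w] ^+ 2).
      by rewrite gw /H !hornerE.
    by rewrite /f; field.
  rewrite 2!unormM unormX ler_wpM2r ?sqr_ge0 // -[leRHS]mulr1.
  rewrite ler_pM ?unorm_ge0 ?(ltW fg) //.
  have g1' := ltW g1.
  have f1 : unorm (f - g w) <= 1 by apply: le_trans (ltW fg) _; lra.
  apply: unormD_le; first by rewrite unorm1.
  by apply: unormD_le => //; exact: unormD_le.
have [CN [kN [lN [dN dN1 [_ NP]]]]] := unorm_horner_near_circle N.
have [CQ [kQ [lQ [dQ dQ1 [/(_ Q0) CQ0 QP]]]]] := unorm_horner_near_circle Q.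
have [CH [kH [lH [dH dH1 [_ HP]]]]] := unorm_horner_near_circle H.
(* The exponent lH + s kH, for s = 1 or 2, is the loss in crossing the circle; |t|^m < 2 makes the
   factor 1/2 of [HQ] absorb it. Having m >= 2 keeps both t and t^2 in the range of the monomial
   formulas. *)
pose m := (lH + 2 * kH).+2.
pose d := Num.min 2 (Num.min dN (Num.min dQ dH)).
have d1 : 1 < d by rewrite !lt_min dN1 dQ1 dH1; lra.
have [t [t1 td]] := exists_unorm_near1 m.-1 c01 d1.
rewrite prednK // in td.
have td2 : unorm t ^+ m < 2 by move: td; rewrite lt_min => /andP[].
have t0 : 0 <= unorm t by exact: unorm_ge0.
have t1' := ltW t1.
have in_d s : (0 < s <= 2)%N ->
    [/\ 1 < unorm (t ^+ s) < dN, 1 < unorm (t ^+ s) < dQ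
      & 1 < unorm (t ^+ s) < dH].
  move=> /andP[s0 s2].
  have : 1 < unorm (t ^+ s) < d.
    rewrite unormX expr_gt1 -?lt0n // t1 (le_lt_trans _ td) //.
    by rewrite ler_eXn2l // (leq_trans s2).
  by rewrite !lt_min => /andP[-> /and3P[_ -> /andP[-> ->]]].
(* Evaluating [HQ] at 1/t, inside the disc, compares the constants that also govern the outside. *)
have HCQ : CH <= 2^-1 * CQ ^+ 2 * unorm t ^+ lH.
  have [_ tQ tH] := in_d 1 isT; rewrite expr1 in tQ tH.
  have [_ <-] := HP t tH; rewrite ler_wpM2r ?exprn_ge0 //.
  have tV : unorm t^-1 < 1 by rewrite unormV invf_lt1 //; lra.
  apply: le_trans (HQ _ tV) _; rewrite ler_wpM2l ?invr_ge0 //.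
  have [_ <-] := QP t tQ.
  rewrite ler_pXn2r ?nnegrE ?mulr_ge0 ?exprn_ge0 ?unorm_ge0 //.
  by rewrite ler_peMr ?unorm_ge0 // exprn_ege1.
have outer s : (0 < s <= 2)%N ->
    (CN * unorm t ^+ (s * kN)) ^+ 2
    = unorm t ^+ s * (CQ * unorm t ^+ (s * kQ)) ^+ 2.
  move=> s12; have [zN zQ zH] := in_d s s12.
  have [e1 _] := NP _ zN; have [e2 _] := QP _ zQ; have [e3 _] := HP _ zH.
  rewrite !exprM -unormX -e1 -e2; apply: unorm_quadratic_root.
    by case/andP: zN.
  have -> : N.[t ^+ s] ^+ 2 + N.[t ^+ s] * Q.[t ^+ s] - t ^+ s * Q.[t ^+ s] ^+ 2
      = H.[t ^+ s] by rewrite /H !hornerE.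
  rewrite e3 e2; have zk0 : 0 <= unorm (t ^+ s) ^+ kH by rewrite exprn_ge0 ?unorm_ge0.
  apply: le_lt_trans (ler_wpM2r zk0 HCQ) _.
  apply: (@lt_le_trans _ _ (CQ ^+ 2)); last first.
    by rewrite exprMn ler_peMr ?sqr_ge0 // !exprn_ege1 // ltW; case/andP: zQ.
  rewrite unormX -exprM -!mulrA -exprD.
  have lt2 : unorm t ^+ (lH + s * kH) < 2.
    apply: le_lt_trans td2; rewrite ler_eXn2l // /m -addn2.
    case/andP: s12 => _ s2.
    by rewrite (leq_trans _ (leq_addr _ _)) // leq_add2l leq_mul2r s2 orbT.
  have CQ2 : 0 < CQ ^+ 2 by rewrite exprn_gt0.
  nra.
have o1 := outer 1 isT; have o2 := outer 2 isT.
move: o1 o2; rewrite !mul1n expr1.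
have t_gt0 : 0 < unorm t by lra.
rewrite ![(2 * _)%N]mulnC !exprM => o1 o2.
set a := unorm t ^+ kN in o1 o2; set b := unorm t ^+ kQ in o1 o2.
(* Quotient of the relations at t^2 and at t, which eliminates [CN] and [CQ]. *)
have ab : a ^+ 2 = unorm t * b ^+ 2.
  have u0 : unorm t * (CQ * b) ^+ 2 != 0.
    by rewrite gt_eqF // mulr_gt0 // exprn_gt0 // mulr_gt0 // exprn_gt0.
  apply: (mulfI u0); rewrite -{1}o1.
  transitivity ((CN * a ^+ 2) ^+ 2); first by ring.
  by rewrite o2; ring.
have : unorm t ^+ (kN * 2) = unorm t ^+ (kQ * 2).+1 by rewrite exprS !exprM.
move=> /(ieexprIn t_gt0); rewrite gt_eqF // => /(_ isT) /(congr1 odd).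
by rewrite /= !muln2 !odd_double.
Qed.

(** * The open unit disc *)

(** If |a| < 1, the disc is also centred at a and meets every annulus around a with r < 1, norm
    values being dense below 1. If |a| >= 1, |z - a| = |a| is constant on the disc. *)
Lemma infraconnected_unorm_lt1 (c : K) : 0 < unorm c < 1 ->
  infraconnected [set z : K | unorm z < 1].
Proof.
move=> c01 a r r' r0 rr' disj.
have nB z : r < unorm (z - a) < r' -> unorm z < 1 -> False.
  by move=> za z1; have : set0 z by rewrite -disj.
have [a1|a1] := ltP (unorm a) 1.
  have [r1|r1] := leP 1 r.
    left=> z /= z1; apply: le_trans r1; apply: unormD_le; first exact: ltW.
    by rewrite unormN ltW.
  have [||z /andP[rz]] := @exists_unorm_between c r (Num.min r' 1) c01 r0.
  - by rewrite lt_min rr'.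
  - by rewrite ge_min lexx orbT.
  rewrite lt_min => /andP[zr' z1]; exfalso; apply: (nB (z + a)).
    by rewrite addrK rz.
  exact: unormD_lt.
have aB z : unorm z < 1 -> unorm (z - a) = unorm a.
  by move=> z1; rewrite unormBr // (lt_le_trans z1).
have [ar|ra] := leP (unorm a) r; first by left=> z /= /aB ->.
right; rewrite -subset0 => z [/= z1]; rewrite aB // => ar'.
by apply: (nB z) => //; rewrite aB // ra.
Qed.

(** The two roots z and -1 - z have product -w, of norm less than 1, so they cannot both lie outside
    the disc. *)
Lemma exists_quadratic_root_lt1 (w : K) : unorm w < 1 ->
  exists2 z : K, unorm z < 1 & z + z ^+ 2 = w.
Proof.
move=> w1; have [|z /rootP] := K_closed (F := 'X^2 + 'X - w%:P).
  by rewrite -addrA size_polyDl ?size_polyXn ?size_XsubC.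
rewrite !hornerE => /eqP; rewrite subr_eq0 addrC => /eqP zw.
have [z1|z1] := ltP (unorm z) 1; first by exists z.
exists (- 1 - z); last by rewrite -zw; ring.
rewrite -opprD unormN ltNge; apply/negP => z'1.
have : 1 * 1 <= unorm z * unorm (1 + z) by rewrite ler_pM.
by rewrite mul1r -unormM mulrDr mulr1 -expr2 zw leNgt w1.
Qed.

End UltrametricNorm.

(** * The theorem over C_p *)

Lemma padic_norm_prime (R : realType) (p : nat) : prime p ->
  padic_norm R p p%:R = p%:R^-1.
Proof.
move=> pp; have p0 := prime_gt0 pp; rewrite /padic_norm pnatr_eq0 gtn_eqF //.
rewrite -[p%:R : rat]/(p%:Z%:~R) numq_int denq_int /= logn1.
by rewrite -[X in logn p X]expn1 pfactorK.
Qed.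

Theorem mainTheorem2 (R : realType) (p : nat) (p_prime : prime p)
    (K : ultrametricFieldType R) (K_Cp : is_padic_complex K p) :
  let P : {poly K} := 'X + 'X^2 in
  let B : set K := [set z | unorm z < 1] in
  (infraconnected B /\ open B) /\
  horner P @` B = B /\
  (forall x y, B x -> B y -> unorm (P.[x] - P.[y]) = unorm (x - y)) /\
  (forall x y, B x -> B y -> x != y ->
    unorm ((P.[x] - P.[y]) / (x - y)) ^+ 2 = unorm (P^`().[x] * P^`().[y])) /\
  analytic_element B (horner P) /\
  ~ bi_analytic B (horner P).
Proof.
move=> P B; have [Kp [_ _ Kroot] _] := K_Cp.
have Kc (F : {poly K}) : (1 < size F)%N -> exists x, root F x.
  move=> F1; have [|x _ Fx] := Kroot F _ F1; last by exists x.
  by rewrite qualifE; apply/allP.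
(* The prime p, of norm 1/p, serves as the [c] of the lemmas above. *)
have c01 : 0 < unorm (p%:R : K) < 1.
  have := Kp p%:R; rewrite ratr_nat padic_norm_prime // => ->.
  by rewrite invr_gt0 invf_lt1 ltr0n ?ltr1n prime_gt0 ?prime_gt1.
have PE x : P.[x] = x + x ^+ 2 by rewrite /P !hornerE.
have BP x : B x -> B P.[x].
  move=> x1; rewrite PE /B /= unormD_lt // unormX expr2.
  by rewrite mulr_ilt1 ?unorm_ge0.
have surj w : B w -> exists2 z, B z & P.[z] = w.
  move=> w1; have [z z1 zw] := exists_quadratic_root_lt1 Kc w1.
  by exists z => //; rewrite PE.
have PB : horner P @` B = B.
  by apply/seteqP; split=> [_ [x Bx <-]|w /surj[z Bz <-]]; [exact: BP|exists z].
have unorm1D x : B x -> unorm (1 + x) = 1.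
  by move=> x1; rewrite unormDl unorm1.
have isoP x y : B x -> B y -> unorm (P.[x] - P.[y]) = unorm (x - y).
  move=> x1 y1; have -> : P.[x] - P.[y] = (x - y) * (1 + (x + y)).
    by rewrite !PE; ring.
  by rewrite unormM unorm1D ?mulr1 //; exact: unormD_lt.
split.
  split; last exact: open_unorm_lt1.
  exact: (infraconnected_unorm_lt1 Kc c01).
split=> //; split=> //; split.
  move=> x y x1 y1 xy; rewrite unormM unormV isoP // divff; last first.
    by rewrite unorm_eq0 subr_eq0.
  have dP z : B z -> unorm P^`().[z] = 1.
    move=> z1; have -> : P^`().[z] = 1 + (z + z).
      by rewrite /P derivD derivX derivXn !hornerE.
    by rewrite unorm1D //; exact: unormD_lt.
  by rewrite unormM !dP // expr1n mulr1.
split; first exact: analytic_element_poly.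
(* As P maps the disc onto itself, its inverse g is defined on the whole disc and is a branch of g +
   g^2 = w there. *)
move=> [_ _ [g [gK]]]; rewrite PB => /(analytic_element_approx (e := 2^-1)).
case=> [|N [Q NQ]]; first by rewrite invr_gt0.
apply: (quadratic_branch_not_rational Kc c01 _ NQ) => w /surj[z z1 <-].
by rewrite gK // PE.
Qed.
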